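(* For each $s\in\mathbb{N}$ there exists a constant $C_2=C_2(\ell,\tau)$ such that for any $\boldsymbol{\xi}=(\xi_1,\dots,\xi_s)$ forming a $(\Delta,\rho,s,\ell,\tau)$-clustered configuration (with $\Delta>0$, $\rho\ge0$, $2\le\ell\le s$, $\ell-1\le\tau\le\pi/\Delta$), and any $N\in\mathbb{N}$ satisfying $N\le\frac{1}{2\Delta}$, we have \[ \sigma_{\min}\big(U_N(\boldsymbol{\xi})\big)\le C_2\,(N\Delta)^{2\ell-1}. \]
   Context: For $N\in\mathbb{N}$ and pairwise distinct real nodes $\boldsymbol{\xi}=(\xi_1,\dots,\xi_s)$, $\xi_j\in(-\pi,\pi]$, put $z_j=e^{i\xi_j}$ and define the $(2N+1)\times 2s$ confluent Vandermonde matrix \[U_N(\boldsymbol{\xi}) = \frac{1}{\sqrt{2N}}\big[\, z_j^k \quad k z_j^{k-1}\,\big]^{j=1,\dots,s}_{k=0,\dots,2N},\] i.e. row $k$ has entries $z_1^k,\dots,z_s^k, kz_1^{k-1},\dots,kz_s^{k-1}$ (scaled by $1/\sqrt{2N}$). $\sigma_{\min}$ denotes the smallest singular value. Wraparound distance: $\|t\|_{\tilde{\mathbb{T}}}=|\mathrm{Arg}\,e^{it}|$, with $\mathrm{Arg}$ the principal argument in $(-\pi,\pi]$. Clustered configuration: for $\Delta>0$, $2\le\ell\le s$, $\ell-1\le\tau\le\pi/\Delta$, $\rho\ge0$, a node vector $\boldsymbol{x}=(x_1,\dots,x_s)\subset(-\frac{\pi}{2},\frac{\pi}{2}]$ of distinct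 nodes forms a $(\Delta,\rho,s,\ell,\tau)$-clustered configuration if for each $x_j$ there is a subset $\boldsymbol{x}^{(j)}=\{x_{j,1},\dots,x_{j,r_j}\}\subset\boldsymbol{x}$ of $1\le r_j\le\ell$ distinct nodes with $x_{j,1}=x_j$ such that (1) $\Delta\le\|y-x_j\|_{\tilde{\mathbb{T}}}\le\tau\Delta$ for all $y\in\boldsymbol{x}^{(j)}\setminus\{x_j\}$, and (2) $\|y-x_j\|_{\tilde{\mathbb{T}}}\ge\rho$ for all $y\in\boldsymbol{x}\setminus\boldsymbol{x}^{(j)}$.
   Formalization: The formal theorem also assumes that at least one cluster x^(j) has exactly ℓ nodes; without this the claim fails (s=ℓ=2, τ=1, ρ=0, nodes 0 and 1 with singleton clusters, N=2, Δ→0). N is taken ≥ 1. *)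

(* Defs.v *)
From HB Require Import structures.
From mathcomp Require Import all_boot all_order all_algebra.
From mathcomp Require Import all_classical all_reals.
From mathcomp Require Import topology normedtype sequences exp trigo.
From mathcomp Require Import complex.
Set Implicit Arguments. Unset Strict Implicit. Unset Printing Implicit Defensive.
Import Order.TTheory GRing.Theory Num.Theory.
Local Open Scope ring_scope.

Section Defs.
Variable R : realType.

(* principal argument of e^{it}: the unique t - 2 pi k lying in (-pi, pi] *)
Definition arg_exp (t : R) : R :=
  t - 2 * pi * (Num.ceil ((t - pi) / (2 * pi)))%:~R.

Definition tdist (t : R) : R := `| arg_exp t |.

Definition cexpi (x : R) : R[i] := (cos x +i* sin x)%C.

Definition confVand_entry (s N : nat) (xi : 'I_s -> R) (k : nat) (j : 'I_(s + s))
  : R[i] :=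
  ((Num.sqrt (N.*2)%:R)^-1)%:C%C *
    match fintype.split j with
    | inl j1 => cexpi (xi j1) ^+ k
    | inr j2 => (k%:R) * cexpi (xi j2) ^+ k.-1
    end.

Definition confVand (s N : nat) (xi : 'I_s -> R) : 'M[R[i]]_(N.*2.+1, s + s) :=
  \matrix_(k, j) confVand_entry N xi k j.

Definition cnorm2 (n : nat) (v : 'cV[R[i]]_n) : R :=
  \sum_(i < n) (complex.Re (v i 0) ^+ 2 + complex.Im (v i 0) ^+ 2).

(* smallest singular value sigma_n(A) of an m x n complex matrix, via
   sigma_min(A) = min_{||x||=1} ||A x|| *)
Definition sigma_min (m n : nat) (A : 'M[R[i]]_(m, n)) : R :=
  inf [set Num.sqrt (cnorm2 (A *m x)) | x in [set x : 'cV[R[i]]_n | cnorm2 x = 1]].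

(* (Delta, rho, s, l, tau)-clustered configuration with a given choice of
   clusters S j = x^{(j)} (as index sets; nodes are distinct) *)
Definition clustered_with (s l : nat) (Delta rho tau : R) (x : 'I_s -> R)
    (S : 'I_s -> {set 'I_s}) : Prop :=
  [/\ injective x,
      (forall j, - (pi / 2) < x j <= pi / 2) &
      forall j, [/\ j \in S j, (1 <= #|S j| <= l)%N,
        (forall y, y \in S j -> y != j ->
            Delta <= tdist (x y - x j) <= tau * Delta) &
        (forall y, y \notin S j -> rho <= tdist (x y - x j))]].

Definition clustered (s l : nat) (Delta rho tau : R) (x : 'I_s -> R) : Prop :=
  exists S, clustered_with l Delta rho tau x S.

Definition clustered_full (s l : nat) (Delta rho tau : R) (x : 'I_s -> R) : Prop :=
  exists S, clustered_with l Delta rho tau x S /\ exists j, #|S j| = l.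

End Defs.

(* Main.v *)
(* Fix a cluster S of l nodes and put m = 2l - 1.  A vector x supported on the
   2l columns of the cluster encodes the functional
   L q = sum_(j in S) (a_j q(z_j) + b_j q'(z_j)), and the k-th entry of U_N x is
   L X^k / sqrt (2N).  Choose x of norm 1 with L X^k = 0 for k < m, which is m
   equations in 2l unknowns.  Since L kills the multiples of
   prod_(j in S) (X - z_j)^2 and |z_j| = 1, the moments satisfy
   |L X^k| <= k^m |L X^m|.  Testing L on a polynomial f of degree m with
   f'(z_j) = 0 at all cluster nodes and f(z_j) = O(Delta^m) gives
   |L X^m| = O(Delta^m) with no lower bound on the node separation. *)
Require Import Defs.
From HB Require Import structures.
From mathcomp Require Import all_boot all_order all_algebra.
From mathcomp Require Import all_classical all_reals.
From mathcomp Require Import topology normedtype sequences exp trigo.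
From mathcomp Require Import derive.
From mathcomp Require Import complex.
From mathcomp Require Import ring lra zify.
Set Implicit Arguments. Unset Strict Implicit. Unset Printing Implicit Defensive.
Import Order.TTheory GRing.Theory Num.Theory.
Import numFieldNormedType.Exports.
Local Open Scope ring_scope.

(** * Growth of moments from annihilated roots *)

(* Induction on the roots: q |-> L (q * (X - w)) satisfies the hypotheses for ws. *)
Lemma functional_growth (F : numFieldType) (L : {poly F} -> F) (w : F) (ws : seq F) :
  scalar L ->
  all (fun v => `|v| <= 1) (w :: ws) ->
  (forall q, L (q * \prod_(v <- w :: ws) ('X - v%:P)) = 0) ->
  (forall k, (k < size ws)%N -> L 'X^k = 0) ->
  forall k, `|L 'X^k| <= (k ^ size ws)%:R * `|L 'X^(size ws)|.
Proof.
elim: ws w L => [|v ws IH] w L linL /= /andP[w1 ws1] Lprod Llow k.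
  (* With the single root [w] the moments form a geometric sequence of ratio [w], hence do not
     grow. *)
  rewrite expn0 mul1r; elim: k => [|k IHk] //.
  suff -> : L 'X^(k.+1) = w * L 'X^k.
    by rewrite normrM (le_trans _ IHk) // ler_piMl.
  have := Lprod 'X^k; rewrite big_seq1 mulrBr -exprSr mulrC mul_polyC addrC.
  by rewrite -scaleNr linL mulNr addrC => /eqP; rewrite subr_eq0 => /eqP.
pose L' q := L (q * ('X - w%:P)).
have L'X i : L' 'X^i = L 'X^(i.+1) - w * L 'X^i.
  rewrite /L' mulrBr -exprSr [_ * w%:P]mulrC mul_polyC addrC.
  by rewrite -scaleNr linL mulNr addrC.
have linL' : scalar L' by move=> a p q; rewrite /L' mulrDl -scalerAl linL.
have L'prod q : L' (q * \prod_(u <- v :: ws) ('X - u%:P)) = 0.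
  by rewrite /L' mulrAC -mulrA -(Lprod q) [in RHS]big_cons.
have L'low i : (i < size ws)%N -> L' 'X^i = 0.
  by move=> lti; rewrite L'X !Llow ?mulr0 ?subr0 // ltnS // ltnW.
(* Since [L] vanishes on the next lower power, [L] and [L'] share their top moment, so the bound on
   [L'] is already expressed through [L]. *)
have L'top : L' 'X^(size ws) = L 'X^((size ws).+1).
  by rewrite L'X [L 'X^(size ws)]Llow // mulr0 subr0.
have bnd := IH v L' linL' ws1 L'prod L'low.
elim: k => [|k IHk]; first by rewrite Llow // normr0 mulr_ge0.
have -> : L 'X^(k.+1) = L' 'X^k + w * L 'X^k by rewrite L'X subrK.
apply: (le_trans (ler_normD _ _)); rewrite normrM.
have wk : `|w| * `|L 'X^k| <= `|L 'X^k| by rewrite ler_piMl.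
apply: (le_trans (lerD (bnd k) (le_trans wk IHk))).
rewrite L'top -mulrDl -natrD ler_wpM2r // ler_nat.
(* With [n = size ws], the two factors add up to [k^n + k^(n+1) = k^n * (k+1)], at most
   [(k+1)^(n+1)]. *)
rewrite /= !expnS -mulSn leq_mul //.
by case: (size ws) => // n; rewrite leq_exp2r.
Qed.

(** * Weighted coefficient norm and antiderivatives *)

(** The l1 norm of the coefficients after rescaling to the disc of radius [D]; it dominates the
    values of [p] on that disc. *)
Definition wnorm (F : numFieldType) (D : F) (p : {poly F}) : F :=
  \sum_(i < size p) `|p`_i| * D ^+ i.

Lemma wnorm_widen (F : numFieldType) (D : F) (p : {poly F}) n :
  (size p <= n)%N -> wnorm D p = \sum_(i < n) `|p`_i| * D ^+ i.
Proof.
move=> lepn; rewrite /wnorm (big_ord_widen _ (fun i => `|p`_i| * D ^+ i) lepn).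
rewrite big_mkcond /=; apply: eq_bigr => i _; case: ltnP => // lei.
by rewrite nth_default // normr0 mul0r.
Qed.

(** Multiplication by [X] shifts the weights and costs exactly [D]; multiplication by [c] costs at
    most [D]. *)
Lemma wnorm_mulXsubC (F : numFieldType) (D c : F) (p : {poly F}) :
  `|c| <= D -> wnorm D (p * ('X - c%:P)) <= 2 * D * wnorm D p.
Proof.
move=> cD; have D0 : 0 <= D := le_trans (normr_ge0 _) cD.
have sz : (size (p * ('X - c%:P))%R <= (size p).+1)%N.
  by apply: leq_trans (size_polyMleq _ _) _; rewrite size_XsubC addn2.
rewrite (wnorm_widen _ sz).
have coefE i : (p * ('X - c%:P))`_i = (p * 'X)`_i - c * p`_i.
  by rewrite mulrBr coefB coefMC [_ * c]mulrC.
apply: (@le_trans _ _ (\sum_(i < (size p).+1) `|(p * 'X)`_i| * D ^+ i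
                       + \sum_(i < (size p).+1) D * (`|p`_i| * D ^+ i))).
  rewrite -big_split; apply: ler_sum => i _ /=.
  rewrite coefE mulrA -mulrDl ler_wpM2r ?exprn_ge0 //.
  by rewrite (le_trans (ler_normB _ _)) // lerD2l normrM ler_wpM2r.
rewrite -mulr_sumr -(wnorm_widen D (leqnSn _)).
rewrite big_ord_recl coefMX /= normr0 mul0r add0r.
rewrite -mulrA mulr_natl mulr2n lerD2r mulr_sumr.
by apply: ler_sum => i _; rewrite coefMX /= exprS mulrCA.
Qed.

Lemma wnorm_prod_XsubC (F : numFieldType) (D : F) (rs : seq F) :
  0 <= D -> all (fun c => `|c| <= D) rs ->
  wnorm D (\prod_(c <- rs) ('X - c%:P)) <= (2 * D) ^+ size rs.
Proof.
move=> D0; elim: rs => [|c rs IH] /=.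
  by rewrite big_nil /wnorm size_poly1 big_ord1 coef1 normr1 mul1r.
move=> /andP[cD rsD]; rewrite big_cons mulrC exprS.
apply: le_trans (wnorm_mulXsubC _ cD) _.
by rewrite ler_wpM2l ?IH // mulr_ge0.
Qed.

(** The primitive vanishing at 0: at index 0 the division by zero yields 0. *)
Definition antideriv (F : numFieldType) (p : {poly F}) : {poly F} :=
  \poly_(i < (size p).+1) (p`_i.-1 / i%:R).

Lemma deriv_antideriv (F : numFieldType) (p : {poly F}) : (antideriv p)^`() = p.
Proof.
apply/polyP => i; rewrite coef_deriv coef_poly ltnS.
case: ltnP => [_|lei]; last by rewrite mul0rn nth_default.
by rewrite -(mulr_natr (_ / _)) divfK ?pnatr_eq0.
Qed.

(** Integration turns the weight [D^i] into [D^(i+1)] and divides by [i + 1 >= 1], which only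
    shrinks the term. *)
Lemma norm_antideriv_le (F : numFieldType) (D y : F) (p : {poly F}) :
  `|y| <= D -> `|(antideriv p).[y]| <= D * wnorm D p.
Proof.
move=> yD; have D0 : 0 <= D := le_trans (normr_ge0 _) yD.
rewrite /antideriv horner_poly big_ord_recl invr0 mulr0 mul0r add0r.
apply: le_trans (ler_norm_sum _ _ _) _.
rewrite mulr_sumr; apply: ler_sum => i _; rewrite /= add0n.
rewrite !normrM normrX normfV mulrCA -exprS.
rewrite ler_pM ?exprn_ge0 ?mulr_ge0 ?invr_ge0 //.
  by rewrite ler_piMr // normr_nat invf_le1 ?ltr0n // ler1n.
by rewrite lerXn2r // ?nnegrE.
Qed.

Lemma size_antideriv (F : numFieldType) (p : {poly F}) :
  p != 0 -> size (antideriv p) = (size p).+1.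
Proof.
move=> p0; rewrite size_poly_eq //= mulf_neq0 ?invr_eq0 ?pnatr_eq0 ?size_poly_eq0 //.
by rewrite -lead_coefE lead_coef_eq0.
Qed.

Lemma lead_coef_antideriv (F : numFieldType) (p : {poly F}) :
  p != 0 -> lead_coef (antideriv p) = lead_coef p / (size p)%:R.
Proof.
by move=> p0; rewrite lead_coefE size_antideriv //= coef_poly ltnSn -lead_coefE.
Qed.

(** * Moments of functionals in values and first derivatives *)

Lemma scalar_sum (F : numFieldType) (L : {poly F} -> F) (p : {poly F}) :
  scalar L -> L p = \sum_(i < size p) p`_i * L 'X^i.
Proof.
move=> linL; have L0 : L 0 = 0.
  by have /= := linL (-1) 0 0; rewrite scaler0 add0r mulN1r addNr.
rewrite -[p in LHS]coefK poly_def.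
elim/big_rec2: _ => // i x y _ <-.
by rewrite linL.
Qed.

Lemma scalar_hermite (F : numFieldType) (I : finType) (S : {set I}) (z a b : I -> F) :
  scalar (fun q : {poly F} => \sum_(j in S) (a j * q.[z j] + b j * q^`().[z j])).
Proof.
move=> c p q; rewrite mulr_sumr -big_split /=; apply: eq_bigr => j _.
by rewrite derivD derivZ !(hornerD, hornerZ); ring.
Qed.

(* The test polynomial f, with f' = (X - w)^e * prod (X - z_j) and f(w) = 0,
   has no derivative contribution in L f, so L f only involves the values
   f(z_j), which are of order D^(deg f). *)
Lemma small_moment (F : numFieldType) (I : finType) (S : {set I})
    (z a b : I -> F) (D w : F) (e : nat) :
  (forall j, j \in S -> `|z j - w| <= D) -> 0 <= D ->
  let L (q : {poly F}) := \sum_(j in S) (a j * q.[z j] + b j * q^`().[z j]) in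
  (forall k, (k <= #|S| + e)%N -> L 'X^k = 0) ->
  `|L 'X^((#|S| + e).+1)| <=
    (#|S| + e).+1%:R * (\sum_(j in S) `|a j|) * (D * (2 * D) ^+ (#|S| + e)).
Proof.
move=> zD D0 L Llow.
(* The roots of [f'] recentred at [w]. The [e] zeros raise the degree of [f] to the order of the
   first moment not assumed to vanish. *)
pose rs := [seq z j - w | j <- enum S] ++ nseq e 0.
have szrs : size rs = (#|S| + e)%N by rewrite size_cat size_map -cardE size_nseq.
have rsD : all (fun c => `|c| <= D) rs.
  rewrite all_cat all_nseq normr0 D0 orbT andbT; apply/allP => c /mapP[j].
  by rewrite mem_enum => jS ->; exact: zD.
pose h := \prod_(c <- rs) ('X - c%:P).
have hz j : j \in S -> h.[z j - w] = 0.
  move=> jS; apply/rootP; rewrite root_prod_XsubC mem_cat.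
  by apply/orP; left; apply/mapP; exists j; rewrite ?mem_enum.
have hmon : h \is monic by exact: monic_prod_XsubC.
have h0 := monic_neq0 hmon.
have szh : size h = (#|S| + e).+1 by rewrite size_prod_XsubC szrs.
pose f := antideriv h \Po ('X - w%:P).
have szf : size f = (#|S| + e).+2.
  by rewrite size_comp_poly2 ?size_XsubC // size_antideriv // szh.
have lcf : f`_(#|S| + e).+1 = (#|S| + e).+1%:R^-1.
  have <- : lead_coef f = f`_(#|S| + e).+1 by rewrite lead_coefE szf.
  rewrite lead_coef_comp ?size_XsubC // lead_coef_antideriv // lead_coefXsubC.
  by rewrite (monicP hmon) szh expr1n mulr1 mul1r.
have linL : scalar L := scalar_hermite S z a b.
(* All lower moments vanish, so only the leading coefficient of [f], the inverse of its degree,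
   contributes. *)
have Lf : L f = (#|S| + e).+1%:R^-1 * L 'X^((#|S| + e).+1).
  rewrite (scalar_sum _ linL) szf big_ord_recr /= lcf big1 ?add0r // => i _.
  by rewrite Llow ?mulr0 // -ltnS.
have -> : L 'X^((#|S| + e).+1) = (#|S| + e).+1%:R * L f.
  by rewrite Lf mulVKf // pnatr_eq0.
rewrite normrM normr_nat -mulrA ler_wpM2l // mulr_suml.
apply: le_trans (ler_norm_sum _ _ _) _; apply: ler_sum => j jS.
have -> : f^`().[z j] = 0.
  by rewrite deriv_comp deriv_antideriv hornerM horner_comp !hornerE hz ?mul0r.
rewrite mulr0 addr0 normrM ler_wpM2l // horner_comp !hornerE.
apply: le_trans (norm_antideriv_le _ (zD j jS)) _.
by rewrite ler_wpM2l // -szrs wnorm_prod_XsubC.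
Qed.

(** The rows of [A] indexed by [S] outnumber its columns, hence are dependent; the coefficients are
    extended by zero outside [S]. *)
Lemma kernel_supported (F : fieldType) (n m : nat) (S : {set 'I_n}) (A : 'M[F]_(n, m)) :
  (m < #|S|)%N ->
  exists x : 'rV[F]_n, [/\ x != 0, x *m A = 0 & forall j, j \notin S -> x 0 j = 0].
Proof.
move=> ltm; pose g (i : 'I_#|S|) : 'I_n := enum_val i.
have : kermx (rowsub g A) != 0.
  rewrite kermx_eq0 /row_free; apply: contraTneq ltm => <-.
  by rewrite -leqNgt rank_leq_col.
move=> /matrix0Pn[r [c krc]]; pose u := row r (kermx (rowsub g A)).
exists (u *m rowsub g 1%:M); have xE i : (u *m rowsub g 1%:M) 0 (g i) = u 0 i.
  have rowE i' : rowsub g 1%:M i' (g i) = (i' == i)%:R :> F.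
    by rewrite !mxE (inj_eq enum_val_inj).
  rewrite [LHS]mxE (bigD1 i) //= rowE eqxx mulr1 big1 ?addr0 // => i' ni.
  by rewrite rowE (negPf ni) mulr0.
split.
- apply: contraNneq krc => /matrixP /(_ 0 (g c)).
  by rewrite xE !mxE => ->.
- by rewrite -mulmxA -rowsubE /u -row_mul mulmx_ker row0.
- move=> j jS; rewrite mxE big1 // => i _; rewrite !mxE.
  by case: eqP jS => [<-|_]; rewrite ?mulr0 // enum_valP.
Qed.

(** Combines the growth bound with the estimate of the top moment: multiples of the squared node
    polynomial have double zeros at the nodes, where [L] reads only values and first derivatives. *)
Lemma moment_bound (F : numFieldType) (I : finType) (S : {set I})
    (z a b : I -> F) (D w : F) (e : nat) :
  #|S| = e.+2 ->
  (forall j, j \in S -> `|z j| <= 1) ->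
  (forall j, j \in S -> `|z j - w| <= D) -> 0 <= D ->
  let L (q : {poly F}) := \sum_(j in S) (a j * q.[z j] + b j * q^`().[z j]) in
  (forall k, (k <= #|S| + e)%N -> L 'X^k = 0) ->
  forall k, `|L 'X^k| <= (k ^ (#|S| + e).+1)%:R *
    ((#|S| + e).+1%:R * (\sum_(j in S) `|a j|) * (D * (2 * D) ^+ (#|S| + e))).
Proof.
move=> cardS z1 zD D0 L Llow k.
pose P := \prod_(j in S) ('X - (z j)%:P).
have Pz j : j \in S -> P.[z j] = 0.
  by move=> jS; rewrite /P (bigD1 j) //= hornerM !hornerE subrr mul0r.
have linL : scalar L := scalar_hermite S z a b.
(* Each node is listed twice. Splitting off one root leaves [2 * #|S| - 1], which is [(#|S| + e).+1]
   because [#|S| = e.+2]. *)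
have [v [vs vvs]] : exists v vs, v :: vs = [seq z j | j <- enum S ++ enum S].
  have : size (enum S) = e.+2 by rewrite -cardE.
  by case: (enum S) => // j js _; exists (z j), [seq z i | i <- js ++ j :: js].
have szvs : size vs = (#|S| + e).+1.
  have : (size vs).+1 = size (v :: vs) by [].
  by rewrite vvs size_map size_cat -!cardE {2}cardS addnS => -[->]; rewrite addnS.
have vs1 : all (fun u => `|u| <= 1) (v :: vs).
  rewrite vvs all_map all_cat andbb; apply/allP => j.
  by rewrite mem_enum; apply: z1.
have prodE : \prod_(u <- v :: vs) ('X - u%:P) = P * P.
  by rewrite vvs big_map big_cat /= !big_enum.
have Lprod q : L (q * \prod_(u <- v :: vs) ('X - u%:P)) = 0.
  rewrite prodE /L big1 // => j jS.
  by rewrite !derivM !(hornerM, hornerD) Pz //; ring.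
have Llow' i : (i < size vs)%N -> L 'X^i = 0.
  by rewrite szvs ltnS; exact: Llow.
apply: le_trans (functional_growth linL vs1 Lprod Llow' k) _.
rewrite szvs ler_wpM2l //.
exact: small_moment zD D0 Llow.
Qed.

(** * Distances on the unit circle *)

Lemma lipschitz1_of_derive (R : realType) (f df : R -> R) (x y : R) :
  (forall t : R, is_derive t 1 f (df t)) -> continuous f -> (forall t, `|df t| <= 1) ->
  `|f x - f y| <= `|x - y|.
Proof.
move=> fdf fc df1; wlog lexy : x y / x <= y.
  by move=> H; case/orP: (le_total x y) => ?; [|rewrite distrC [leRHS]distrC]; apply: H.
have [c _] := MVT_segment lexy (fun t _ => fdf t) (continuous_subspaceT fc).
by rewrite distrC => ->; rewrite normrM [leRHS]distrC ler_piMl.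
Qed.

(** Trades the complex order for a real inequality without square roots; squaring forgets the sign
    of [t], hence the first conjunct. *)
Lemma normC_le (R : realType) (c : R[i]) (t : R) :
  (`|c| <= t%:C%C) = (0 <= t) && (complex.Re c ^+ 2 + complex.Im c ^+ 2 <= t ^+ 2).
Proof.
rewrite normc_def lecR; case: (lerP 0 t) => [t0|t0] /=.
  by rewrite -{1}(ger0_norm t0) -sqrtr_sqr ler_sqrt // sqr_ge0.
by apply/negbTE; rewrite -ltNge (lt_le_trans t0) ?sqrtr_ge0.
Qed.

Lemma norm_cexpi (R : realType) (x : R) : `|cexpi x| = 1.
Proof. by rewrite normc_def /= cos2Dsin2 sqrtr1. Qed.

(** [cos] and [sin] are both 1-Lipschitz, which gives a factor sqrt 2, relaxed to 2. *)
Lemma norm_cexpiB (R : realType) (x y : R) :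
  `|cexpi x - cexpi y| <= (2 * `|x - y|)%:C%C.
Proof.
have hc : `|cos x - cos y| <= `|x - y|.
  apply: (@lipschitz1_of_derive _ _ (fun t => - sin t)) => [|t].
  - exact: continuous_cos.
  - by rewrite normrN sin_max.
have hs : `|sin x - sin y| <= `|x - y|.
  apply: (@lipschitz1_of_derive _ _ cos) => [|t].
  - exact: continuous_sin.
  - exact: cos_max.
rewrite normC_le mulr_ge0 //=.
move: hc hs; rewrite -(ler_sqr (normr_ge0 _) (normr_ge0 _)) real_normK ?num_real //.
rewrite -(ler_sqr (normr_ge0 (sin x - sin y)) (normr_ge0 _)).
rewrite (@real_normK _ (sin x - sin y)) ?num_real //.
have := sqr_ge0 `|x - y|; rewrite exprMn; lra.
Qed.

(** Here [(t - pi) / (2 * pi)] lies in (-1, 0), so its ceiling is 0. Differences of nodes in (-pi/2,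
    pi/2] are always in this range. *)
Lemma tdist_small (R : realType) (t : R) : - pi < t < pi -> tdist t = `|t|.
Proof.
move=> /andP[lt gt]; rewrite /tdist /arg_exp.
have pi0 := pi_gt0 R.
have -> : Num.ceil ((t - pi) / (2 * pi)) = 0.
  apply: ceil_def; rewrite ltr_pdivlMr ?ler_pdivrMr ?mulr_gt0 //; apply/andP; split; lra.
by rewrite mulr0 subr0.
Qed.

(** * Euclidean norm and smallest singular value *)

Lemma cnorm2_ge0 (R : realType) (n : nat) (v : 'cV[R[i]]_n) : 0 <= cnorm2 v.
Proof. by apply: sumr_ge0 => i _; rewrite addr_ge0 ?sqr_ge0. Qed.

Lemma sigma_min_le (R : realType) (m n : nat) (A : 'M[R[i]]_(m, n)) (v : 'cV[R[i]]_n) :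
  cnorm2 v = 1 -> sigma_min A <= Num.sqrt (cnorm2 (A *m v)).
Proof.
move=> v1; apply: ge_inf; last by exists v.
by exists 0 => _ [x _ <-]; rewrite sqrtr_ge0.
Qed.

Lemma cnorm2_normalize (R : realType) (n : nat) (v : 'cV[R[i]]_n) :
  v != 0 -> exists c : R[i], cnorm2 (c *: v) = 1.
Proof.
move=> v0; have vgt : 0 < cnorm2 v.
  rewrite lt_neqAle cnorm2_ge0 andbT eq_sym; apply: contra v0.
  rewrite psumr_eq0 => [|i _]; last by rewrite addr_ge0 ?sqr_ge0.
  move=> /allP v0; apply/eqP/matrixP => i j; rewrite ord1 mxE.
  have := v0 i; rewrite mem_index_enum => /(_ isT).
  rewrite paddr_eq0 ?sqr_ge0 // !sqrf_eq0.
  by case: (v i 0) => re im /= /andP[/eqP -> /eqP ->].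
exists ((Num.sqrt (cnorm2 v))^-1)%:C%C.
rewrite /cnorm2; transitivity ((Num.sqrt (cnorm2 v))^-1 ^+ 2 * cnorm2 v).
  rewrite [in RHS]/cnorm2 mulr_sumr; apply: eq_bigr => i _; rewrite mxE.
  by case: (v i 0) => re im /=; rewrite !mul0r subr0 addr0; ring.
by rewrite exprVn sqr_sqrtr ?ltW // mulVf // gt_eqF.
Qed.

Lemma cnorm2_le (R : realType) (n : nat) (v : 'cV[R[i]]_n) (t : R) :
  (forall k, `|v k 0| <= t%:C%C) -> cnorm2 v <= n%:R * t ^+ 2.
Proof.
move=> vt; rewrite mulr_natl -[in leRHS](card_ord n) -sumr_const.
by apply: ler_sum => i _; have := vt i; rewrite normC_le => /andP[].
Qed.

Lemma norm_entry_le1 (R : realType) (n : nat) (v : 'cV[R[i]]_n) (k : 'I_n) :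
  cnorm2 v = 1 -> `|v k 0| <= 1.
Proof.
move=> v1; rewrite -[1]/(1%:C%C) normC_le ler01 expr1n -v1 /cnorm2 (bigD1 k) //= lerDl.
by apply: sumr_ge0 => i _; rewrite addr_ge0 ?sqr_ge0.
Qed.

(** * Confluent Vandermonde products as moments *)

Lemma sum_confluent (R : realType) (s : nat) (xi : 'I_s -> R) (S : {set 'I_s})
    (x : 'cV[R[i]]_(s + s)) (k : nat) :
  (forall j, j \notin S -> x (lshift s j) 0 = 0 /\ x (rshift s j) 0 = 0) ->
  \sum_(j < s + s) match fintype.split j with
    | inl j1 => cexpi (xi j1) ^+ k
    | inr j2 => k%:R * cexpi (xi j2) ^+ k.-1
    end * x j 0 =
  \sum_(j in S) (x (lshift s j) 0 * ('X^k).[cexpi (xi j)] +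
                 x (rshift s j) 0 * ('X^k)^`().[cexpi (xi j)]).
Proof.
move=> xS; rewrite big_split_ord /= -big_split [RHS]big_mkcond /=.
apply: eq_bigr => j _.
rewrite (unsplitK (inl j)) (unsplitK (inr j)) derivXn hornerMn !hornerXn.
case: ifPn => [_|/xS[-> ->]]; last by rewrite !mulr0 addr0.
by rewrite -mulr_natl; ring.
Qed.

Lemma confVand_mulmx (R : realType) (s N : nat) (xi : 'I_s -> R)
    (x : 'cV[R[i]]_(s + s)) (k : 'I_(N.*2.+1)) :
  (confVand N xi *m x) k 0 = ((Num.sqrt (N.*2)%:R)^-1)%:C%C *
    \sum_(j < s + s) match fintype.split j with
      | inl j1 => cexpi (xi j1) ^+ k
      | inr j2 => k%:R * cexpi (xi j2) ^+ k.-1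
      end * x j 0.
Proof.
rewrite mxE mulr_sumr; apply: eq_bigr => j _.
by rewrite mxE /confVand_entry mulrA.
Qed.

(** The [m] vanishing moments are linear equations in the [2 * #|S|] entries over the cluster
    columns; a nonzero solution is normalised. *)
Lemma unit_annihilator (R : realType) (s : nat) (xi : 'I_s -> R) (S : {set 'I_s}) (m : nat) :
  (m < #|S| + #|S|)%N ->
  exists x : 'cV[R[i]]_(s + s), [/\ cnorm2 x = 1,
    forall j, j \notin S -> x (lshift s j) 0 = 0 /\ x (rshift s j) 0 = 0 &
    forall k, (k < m)%N ->
      \sum_(j in S) (x (lshift s j) 0 * ('X^k).[cexpi (xi j)] +
                 x (rshift s j) 0 * ('X^k)^`().[cexpi (xi j)]) = 0].
Proof.
move=> ltm.
pose S2 := [set j : 'I_(s + s) | match fintype.split j with inl i | inr i => i \in S end].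
have cardS2 : #|S2| = (#|S| + #|S|)%N.
  rewrite -!sum1_card big_mkcond big_split_ord /= [in RHS]big_mkcond /=.
  congr addn; apply: eq_bigr => i _; rewrite inE.
    by rewrite (unsplitK (inl i)).
  by rewrite (unsplitK (inr i)).
rewrite -cardS2 in ltm.
pose A : 'M[R[i]]_(s + s, m) := \matrix_(j, k) match fintype.split j with
    | inl j1 => cexpi (xi j1) ^+ k
    | inr j2 => k%:R * cexpi (xi j2) ^+ k.-1
    end.
have [y [y0 yA yS]] := kernel_supported A ltm.
have yT0 : y^T != 0 by rewrite -(inj_eq (@trmx_inj _ _ _)) trmxK trmx0.
have [c c1] := cnorm2_normalize yT0.
have xS j : j \notin S ->
    (c *: y^T) (lshift s j) 0 = 0 /\ (c *: y^T) (rshift s j) 0 = 0.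
  by move=> jS; rewrite !mxE !yS ?mulr0 // inE ?(unsplitK (inl j)) ?(unsplitK (inr j)).
exists (c *: y^T); split=> // k ltk.
rewrite -sum_confluent //.
have /matrixP/(_ 0 (Ordinal ltk)) := yA; rewrite !mxE => yAk.
transitivity (c * \sum_j y 0 j * A j (Ordinal ltk)); last by rewrite yAk mulr0.
rewrite mulr_sumr; apply: eq_bigr => j _.
by rewrite !mxE /=; ring.
Qed.

(** * The bound on the smallest singular value *)

Theorem theorem3p2 (R : realType) (s l : nat) (tau : R) :
  exists C2 : R,
  forall (Delta rho : R) (xi : 'I_s -> R) (N : nat),
    0 < Delta -> 0 <= rho ->
    (2 <= l <= s)%N ->
    (l%:R - 1 <= tau) -> tau <= pi / Delta ->
    clustered_full l Delta rho tau xi ->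
    (0 < N)%N -> N%:R <= (2 * Delta)^-1 ->
    sigma_min (confVand N xi) <= C2 * (N%:R * Delta) ^+ (l.*2.-1).
Proof.
(* The leading 2 absorbs [sqrt ((2N+1)/(2N))], [l.*2.-1] is the degree of the test polynomial, [s]
   bounds the sum of the [|a_j|], and [8 * tau * N * Delta] is [2N * (2 * D)] for
   [D = 2 * tau * Delta]. *)
exists (2 * (l.*2.-1)%:R * s%:R * (8 * tau) ^+ l.*2.-1).
move=> Delta rho xi N Delta0 _ /andP[l2 _] ltau _ [S0 [[_ xipi HS] [j0 cardS]]] N0 _.
(* This cluster has exactly [l] nodes, all within [tau * Delta] of its centre [j0], whose image on
   the circle serves as [w]. *)
set S := S0 j0 in cardS.
have tau1 : 1 <= tau.
  apply: le_trans ltau; rewrite lerBrDr -[1 + 1]/(2%:R) ler_nat //.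
have tau0 : 0 <= tau := le_trans ler01 tau1.
have Delta0' := ltW Delta0.
have tD0 : 0 <= tau * Delta by rewrite mulr_ge0.
have [e le] : exists e, l = e.+2 by case: (l) l2 => [|[|e]] // _; exists e.
have mE : (#|S| + e).+1 = l.*2.-1 by rewrite cardS le -addnn; lia.
set m := l.*2.-1 in mE *.
have [D DE] : exists D, D = 2 * (tau * Delta) by eexists.
have near_j0 j : j \in S ->
    `|cexpi (xi j) - cexpi (xi j0)| <= D%:C%C.
  move=> jS; apply: le_trans (norm_cexpiB _ _) _; rewrite DE lecR ler_wpM2l //.
  have [->|jj0] := eqVneq j j0; first by rewrite subrr normr0.
  have [_ _ /(_ j jS jj0) /andP[_]] := HS j0; rewrite tdist_small //.
  have /andP[? ?] := xipi j; have /andP[? ?] := xipi j0; apply/andP; split; lra.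
have ltm : (m < #|S| + #|S|)%N by rewrite /m cardS le; lia.
have [x [x1 xS xlow]] := unit_annihilator xi ltm.
apply: le_trans (sigma_min_le _ x1) _.
have [B BE] : exists B, B = (N.*2 ^ m)%:R * (m%:R * s%:R * (D * (2 * D) ^+ (#|S| + e))).
  by eexists.
have D0 : 0 <= D by rewrite DE mulr_ge0.
have B0 : 0 <= B by rewrite BE !(mulr_ge0, exprn_ge0, ler0n).
have entry_le (k : 'I_(N.*2.+1)) :
    `|(confVand N xi *m x) k 0| <= ((Num.sqrt (N.*2)%:R)^-1 * B)%:C%C.
  rewrite confVand_mulmx (sum_confluent _ _ xS) normrM rmorphM /=.
  rewrite ler_pM //; first by rewrite normC_le /= expr0n /= addr0 invr_ge0 sqrtr_ge0 lexx.
  apply: le_trans (moment_bound (D := D%:C%C) (w := cexpi (xi j0)) (e := e) _ _ _ _ _ k) _.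
  - by rewrite cardS le.
  - by move=> j _; rewrite norm_cexpi.
  - exact: near_j0.
  - by rewrite ler0c.
  - by move=> i; rewrite -ltnS mE; exact: xlow.
  have sum_le : \sum_(j in S) `|x (lshift s j) 0| <= s%:R.
    rewrite big_mkcond -[s in leRHS]card_ord -sum1_card natr_sum.
    by apply: ler_sum => j _; case: ifP => _; rewrite ?ler01 // norm_entry_le1.
  have DC0 : 0 <= D%:C%C by rewrite ler0c.
  have D2C0 : 0 <= 2 * D%:C%C by rewrite mulr_ge0.
  rewrite mE BE !(rmorphM, rmorphXn, rmorph_nat) /=.
  rewrite ler_pM ?mulr_ge0 ?exprn_ge0 ?sumr_ge0 //.
    (* The row index [k] is at most [2N]. *)
    by rewrite lerXn2r ?nnegrE ?ler0n // ler_nat -ltnS.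
  rewrite ler_wpM2r ?mulr_ge0 ?exprn_ge0 ?mulr_ge0 // ler_wpM2l //.
have N20 : 0 < (N.*2)%:R :> R by rewrite ltr0n double_gt0.
(* There are [2N+1] rows, and [(2N+1)/(2N) <= 4] as [N > 0]. *)
have cnorm_le : cnorm2 (confVand N xi *m x) <= (2 * B) ^+ 2.
  apply: le_trans (cnorm2_le entry_le) _.
  rewrite !exprMn exprVn sqr_sqrtr ?ler0n // mulrA ler_wpM2r ?sqr_ge0 //.
  by rewrite ler_pdivrMr // -natrX -natrM ler_nat; lia.
apply: (@le_trans _ _ (2 * B)).
  by rewrite -[leRHS]ger0_norm ?mulr_ge0 // -sqrtr_sqr ler_sqrt ?sqr_ge0.
have -> : 2 * m%:R * s%:R * (8 * tau) ^+ m * (N%:R * Delta) ^+ m =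
    2 * ((N.*2 ^ m)%:R * (m%:R * s%:R * (2 * D) ^+ m)).
  rewrite natrX -muln2 natrM DE.
  rewrite -mulrA -exprMn.
  have -> : 8 * tau * (N%:R * Delta) = N%:R * 2 * (2 * (2 * (tau * Delta))) by ring.
  by rewrite [in LHS]exprMn; ring.
rewrite BE ler_wpM2l // ler_wpM2l // ler_wpM2l ?mulr_ge0 //.
(* The lone factor [D] is relaxed to [2 * D] to complete the power [m]. *)
rewrite -mE exprS ler_wpM2r ?exprn_ge0 ?mulr_ge0 //; lra.
Qed.
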